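(* Let $\mathcal{G}$ be a class of graphs that is $\chi$-bounded by an exponential function. Then $\mathcal{G}^*$ is also $\chi$-bounded by an exponential function.
   Context: All graphs are finite and simple, possibly empty; $\omega$ is the clique number and $\chi$ the chromatic number. A class $\mathcal{G}$ is $\chi$-bounded by $f:\mathbb{N}\rightarrow\mathbb{R}$ if for all $G\in\mathcal{G}$ and all (possibly empty) induced subgraphs $H$ of $G$, $\chi(H)\leq f(\omega(H))$. An exponential function here means a function of the form $n\mapsto a\,b^{n}$ with constants $a>0$, $b>1$. Given non-empty graphs $G_1,G_2$ with disjoint vertex sets and $u\in V_{G_1}$, the graph obtained by substituting $G_2$ for $u$ in $G_1$ has vertex set $(V_{G_1}\smallsetminus\{u\})\cup V_{G_2}$, induces $G_1\smallsetminus u$ and $G_2$ on the respective parts, and each $v\in V_{G_1}\smallsetminus\{u\}$ is complete to $V_{G_2}$ if $v$ is adjacent to $u$ and anti-complete to $V_{G_2}$ otherwise. $\mathcal{G}^*$ denotes the closure of $\mathcal{G}$ under taking disjoint unions and substitution. *)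

(* Defs.v *)
From mathcomp Require Import all_boot all_order all_algebra.
From mathcomp Require Import reals.

Set Implicit Arguments.
Unset Strict Implicit.
Unset Printing Implicit Defensive.

Import Order.TTheory GRing.Theory Num.Theory.

Record sgraph := SGraph {
  vertex :> finType;
  adj : rel vertex;
  adj_sym : symmetric adj;
  adj_irrefl : irreflexive adj }.

Definition is_iso (G H : sgraph) (f : G -> H) : Prop :=
  bijective f /\ forall x y : G, adj (f x) (f y) = adj x y.

Definition isomorphic (G H : sgraph) : Prop := exists f : G -> H, is_iso f.

Section Induced.
Variables (G : sgraph) (A : {set G}).

Definition induced_adj : rel {x : G | x \in A} :=
  fun x y => adj (val x) (val y).

Lemma induced_sym : symmetric induced_adj.
Proof. by move=> x y; rewrite /induced_adj adj_sym. Qed.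

Lemma induced_irrefl : irreflexive induced_adj.
Proof. by move=> x; rewrite /induced_adj adj_irrefl. Qed.

Definition induced : sgraph := SGraph induced_sym induced_irrefl.
End Induced.

Definition clique (G : sgraph) (A : {set G}) : bool :=
  [forall x in A, forall y in A, (x != y) ==> adj x y].

Definition omega (G : sgraph) : nat := \max_(A : {set G} | clique A) #|A|.

Definition proper_coloring (G : sgraph) (k : nat) (c : {ffun G -> 'I_k}) : bool :=
  [forall x, forall y, adj x y ==> (c x != c y)].

Definition colorable (G : sgraph) (k : nat) : bool :=
  [exists c : {ffun G -> 'I_k}, proper_coloring c].

Lemma colorable_ex (G : sgraph) : exists k, colorable G k.
Proof.
exists #|G|; apply/existsP; exists [ffun x => enum_rank x].
apply/forallP=> x; apply/forallP=> y; apply/implyP=> xy.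
rewrite !ffunE; apply: contraTneq xy => /enum_rank_inj ->.
by rewrite adj_irrefl.
Qed.

Definition chi (G : sgraph) : nat := ex_minn (colorable_ex G).

Section DisjointUnion.
Variables G1 G2 : sgraph.

Definition dunion_adj : rel (G1 + G2)%type := fun x y =>
  match x, y with
  | inl x1, inl y1 => adj x1 y1
  | inr x2, inr y2 => adj x2 y2
  | _, _ => false
  end.

Lemma dunion_sym : symmetric dunion_adj.
Proof. by case=> x [] y //=; rewrite adj_sym. Qed.

Lemma dunion_irrefl : irreflexive dunion_adj.
Proof. by case=> x /=; rewrite adj_irrefl. Qed.

Definition dunion : sgraph := SGraph dunion_sym dunion_irrefl.
End DisjointUnion.

Section Substitution.
Variables (G1 : sgraph) (u : G1) (G2 : sgraph).

Definition substitute_adj : rel ({x : G1 | x != u} + G2)%type := fun x y =>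
  match x, y with
  | inl x1, inl y1 => adj (val x1) (val y1)
  | inl x1, inr _ => adj (val x1) u
  | inr _, inl y1 => adj (val y1) u
  | inr x2, inr y2 => adj x2 y2
  end.

Lemma substitute_sym : symmetric substitute_adj.
Proof. by case=> x [] y //=; rewrite adj_sym. Qed.

Lemma substitute_irrefl : irreflexive substitute_adj.
Proof. by case=> x /=; rewrite adj_irrefl. Qed.

Definition substitute : sgraph := SGraph substitute_sym substitute_irrefl.
End Substitution.

Definition graph_class := sgraph -> Prop.

(* Vertex sets are types, so the disjointness of the operands is realized by
   sum types, and the resulting graphs are taken up to isomorphism
   ([star_iso]).  In [star_substitute] the graph G1 is non-empty since
   it contains u. *)
Inductive star_closure (C : graph_class) : graph_class :=
| star_base (G : sgraph) : C G -> star_closure C G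
| star_iso (G H : sgraph) : isomorphic G H -> star_closure C G -> star_closure C H
| star_dunion (G1 G2 : sgraph) :
    star_closure C G1 -> star_closure C G2 -> star_closure C (dunion G1 G2)
| star_substitute (G1 : sgraph) (u : G1) (G2 : sgraph) :
    0 < #|G2| -> star_closure C G1 -> star_closure C G2 ->
    star_closure C (substitute u G2).

Local Open Scope ring_scope.

Definition chi_bounded_by (R : realType) (C : graph_class) (f : nat -> R) : Prop :=
  forall G : sgraph, C G ->
  forall A : {set G}, (chi (induced A))%:R <= f (omega (induced A)).

Definition exponential (R : realType) (f : nat -> R) : Prop :=
  exists a b : R, [/\ 0 < a, 1 < b & forall n : nat, f n = a * b ^+ n].

(* Main.v *)
Require Import Defs.
From mathcomp Require Import all_boot all_order all_algebra.
From mathcomp Require Import reals.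
From mathcomp Require Import zify.

(** Let every induced subgraph [H] of a member of [C] satisfy
    [chi H <= K ^ (omega H + 1)], and put [B = 2 K^3 + 1].  Call [G] composable
    if replacing its vertices by graphs that hereditarily satisfy
    [chi <= B ^ omega] always yields such a graph.  Composability is preserved
    by disjoint unions and substitutions, so the point is that the members of
    [C] are composable.  Let [n] be the clique number of the composed graph and
    weigh each vertex of [G] by the clique number of its fiber.  Fibers of
    weight [n] are anticomplete to all others, so they can be coloured
    separately.  The vertices of weight in (n/2, n) form a stable set, hence
    their fibers share [B ^ (n-1)] colours.  The vertices of a given weight
    [0 < j <= n/2] induce a graph with clique number at most [n], hence their
    fibers need at most [K ^ (n+1) * B ^ (n/2)] colours.  The choice of [B]
    makes the total at most [B ^ n]. *)

Set Implicit Arguments.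
Unset Strict Implicit.
Unset Printing Implicit Defensive.

Local Notation set_omega A := (omega (induced A)).
Local Notation set_chi A := (chi (induced A)).

Lemma cliqueP (G : sgraph) (A : {set G}) :
reflect {in A &, forall x y, x != y -> adj x y} (clique A).
Proof.
apply: (iffP forall_inP) => [cA x y xA yA|cA x xA].
  by have /forall_inP/(_ y yA)/implyP := cA x xA.
by apply/forall_inP=> y yA; apply/implyP; apply: cA.
Qed.

Section SetInvariants.
Variable G : sgraph.
Implicit Types (A S T W : {set G}) (x y : G) (k : nat).

Definition anticomplete S T : Prop := {in S & T, forall x y, ~~ adj x y}.

Definition stable S : Prop := anticomplete S S.

Lemma leq_card_clique_omega A S : clique A -> A \subset S -> #|A| <= set_omega S.
Proof.
move=> /cliqueP cA /subsetP sAS.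
have -> : A = val @: [set x : induced S | val x \in A].
  apply/setP=> x; apply/idP/imsetP=> [xA|[y]]; last by rewrite inE => ? ->.
  by exists (Sub x (sAS x xA)); rewrite ?inE ?SubK.
rewrite card_imset; last exact: val_inj.
apply: (leq_bigmax_cond (F := fun Q : {set induced S} => #|Q|)).
by apply/cliqueP=> x y; rewrite !inE => xA yA; apply: cA.
Qed.

Lemma omega_attained S :
  exists A, [/\ clique A, A \subset S & #|A| = set_omega S].
Proof.
have clique_nonempty : 0 < #|[pred Q : {set induced S} | clique Q]|.
  by apply/card_gt0P; exists set0; apply/cliqueP=> x y; rewrite inE.
have [Q /cliqueP cQ omegaE] :=
  eq_bigmax_cond (fun Q : {set induced S} => #|Q|) clique_nonempty.
exists (val @: Q); split.
- apply/cliqueP=> _ _ /imsetP[x xQ ->] /imsetP[y yQ ->] xy.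
  by apply: (cQ x y xQ yQ); apply: contra_neq xy => ->.
- by apply/subsetP=> _ /imsetP[x _ ->]; apply: valP.
- by rewrite /omega omegaE card_imset //; apply: val_inj.
Qed.

Lemma leq_omegaS S T : S \subset T -> set_omega S <= set_omega T.
Proof.
move=> sST; have [A [cA sAS <-]] := omega_attained S.
exact: leq_card_clique_omega cA (subset_trans sAS sST).
Qed.

Lemma omega_gt0 S x : x \in S -> 0 < set_omega S.
Proof.
move=> xS; rewrite -(cards1 x); apply: leq_card_clique_omega; rewrite ?sub1set //.
by apply/cliqueP=> a b /set1P-> /set1P->; rewrite eqxx.
Qed.

Lemma leq_omegaU S T : {in S & T, forall x y, adj x y} ->
  set_omega S + set_omega T <= set_omega (S :|: T).
Proof.
move=> adjST; have [A [/cliqueP cA sAS <-]] := omega_attained S.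
have [A' [/cliqueP cA' sA'T <-]] := omega_attained T.
have adjAA' x y : x \in A -> y \in A' -> adj x y.
  by move=> /(subsetP sAS) xS /(subsetP sA'T); apply: adjST.
have disjAA' : [disjoint A & A'].
  by apply/pred0Pn=> -[x /= /andP[xA /(adjAA' x x xA)]]; rewrite adj_irrefl.
have <- : #|A :|: A'| = #|A| + #|A'|.
  by apply/eqP; rewrite (leq_card_setU A A').2.
apply: leq_card_clique_omega (setUSS sAS sA'T).
apply/cliqueP=> x y /setUP[]xA /setUP[]yA.
- exact: cA.
- by move=> _; apply: adjAA'.
- by move=> _; rewrite adj_sym; apply: adjAA'.
- exact: cA'.
Qed.

Lemma set_chi_leP S k :
  (exists2 c : G -> nat, {in S, forall x, c x < k} &
     {in S &, forall x y, adj x y -> c x != c y}) <-> set_chi S <= k.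
Proof.
rewrite /chi; case: ex_minnP => m colorable_m m_min; split=> [[c c_lt c_proper]|mk].
  apply/m_min/existsP; exists [ffun x => Ordinal (c_lt (val x) (valP x))].
  apply/forallP=> x; apply/forallP=> y; apply/implyP=> xy.
  by rewrite !ffunE -val_eqE; apply: c_proper xy; apply: valP.
have /existsP[c /forallP c_proper] := colorable_m.
exists (fun x => if insub x is Some z then nat_of_ord (c z) else 0).
  by move=> x xS; rewrite (insubT (mem S) xS) (leq_trans _ mk).
move=> x y xS yS xy; rewrite (insubT (mem S) xS) (insubT (mem S) yS).
by have /forallP/(_ (Sub y yS))/implyP := c_proper (Sub x xS); apply.
Qed.

Lemma leq_chiS S T : S \subset T -> set_chi S <= set_chi T.
Proof.
move=> /subsetP sST; apply/set_chi_leP.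
have [c c_lt c_proper] := (set_chi_leP T _).2 (leqnn _).
by exists c; [move=> x /sST/c_lt | move=> x y /sST xT /sST; apply: c_proper].
Qed.

Lemma set_chi0 : set_chi (set0 : {set G}) = 0.
Proof.
by apply/eqP; rewrite -leqn0; apply/set_chi_leP; exists (fun=> 0) => x; rewrite inE.
Qed.

Lemma leq_chi_stable S : stable S -> set_chi S <= 1.
Proof.
move=> stS; apply/set_chi_leP; exists (fun=> 0) => // x y xS yS.
by rewrite (negbTE (stS x y xS yS)).
Qed.

Lemma leq_chiU S T : set_chi (S :|: T) <= set_chi S + set_chi T.
Proof.
have [c c_lt c_proper] := (set_chi_leP S _).2 (leqnn _).
have [d d_lt d_proper] := (set_chi_leP T _).2 (leqnn _).
have inT x : x \in S :|: T -> x \notin S -> x \in T by rewrite inE => /orP[->|].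
apply/set_chi_leP; exists (fun x => if x \in S then c x else set_chi S + d x).
  move=> x xU; case: ifPn => [/c_lt|/(inT x xU)/d_lt] lt_k; first exact: ltn_addr.
  by rewrite ltn_add2l.
move=> x y xU yU xy; case: ifPn => xS; case: ifPn => yS.
- exact: c_proper.
- by rewrite neq_ltn (leq_trans (c_lt x xS)) ?leq_addr.
- by rewrite neq_ltn orbC (leq_trans (c_lt y yS)) ?leq_addr.
- by rewrite eqn_add2l d_proper ?inT.
Qed.

Lemma leq_chi_bigcup (I : finType) (P : pred I) (F : I -> {set G}) :
  set_chi (\bigcup_(i | P i) F i) <= \sum_(i | P i) set_chi (F i).
Proof.
elim/big_rec2: _ => [|i m S _ leSm]; first by rewrite set_chi0.
by apply: leq_trans (leq_chiU _ _) _; rewrite leq_add2l.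
Qed.

Lemma leq_chi_bigcup_anticomplete (I : finType) (P : pred I) (F : I -> {set G}) :
  {in P &, forall i j, i != j -> anticomplete (F i) (F j)} ->
  set_chi (\bigcup_(i | P i) F i) <= \max_(i | P i) set_chi (F i).
Proof.
move=> antiF; apply/set_chi_leP.
have /fin_all_exists2[c c_lt c_proper] := fun i => (set_chi_leP (F i) _).2 (leqnn _).
pose color x := if [pick i | P i && (x \in F i)] is Some i then c i x else 0.
have colorE x : x \in \bigcup_(i | P i) F i ->
    exists2 i, P i && (x \in F i) & color x = c i x.
  move=> /bigcupP[i Pi xFi]; rewrite /color.
  by case: pickP => [j Pj|/(_ i)]; [exists j | rewrite Pi xFi].
exists color => [x /colorE[i /andP[Pi xFi] ->]|].
  apply: leq_trans (c_lt i x xFi) _.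
  exact: (leq_bigmax_cond (F := fun i => set_chi (F i))).
move=> x y /colorE[i /andP[Pi xFi] ->] /colorE[j /andP[Pj yFj] ->] xy.
have [eq_ij|ij] := eqVneq i j; last first.
  by have := antiF i j Pi Pj ij x y xFi yFj; rewrite xy.
by rewrite -eq_ij in yFj *; apply: c_proper.
Qed.

Lemma leq_chiU_anticomplete S T :
  anticomplete S T -> set_chi (S :|: T) <= maxn (set_chi S) (set_chi T).
Proof.
move=> antiST.
have := @leq_chi_bigcup_anticomplete bool predT (fun b => if b then S else T).
rewrite !big_bool; apply=> -[] [] // _ _ _ x y xT yS.
by rewrite adj_sym; apply: antiST.
Qed.

End SetInvariants.

Section Modular.
Variables (G D : sgraph).
Implicit Types (F : G -> {set D}) (Q W : {set G}).

(* The union of the fibers [F v] is seen as the graph obtained from [G] by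
   replacing each vertex [v] by [F v]; an empty fiber deletes its vertex, and
   fibers of non-adjacent vertices may overlap. *)
Definition modular F : Prop :=
  forall u v, u != v -> {in F u & F v, forall x y, adj x y = adj u v}.

Lemma modularI F (T : {set D}) : modular F -> modular (fun v => F v :&: T).
Proof. by move=> modF u v uv x y /setIP[xFu _] /setIP[yFv _]; apply: modF. Qed.

Lemma modular_adj F u v : modular F -> adj u v -> {in F u & F v, forall x y, adj x y}.
Proof.
move=> modF uv x y xFu yFv; rewrite (modF u v) //.
by apply: contraTneq uv => ->; rewrite adj_irrefl.
Qed.

Lemma leq_omega_modular_adj F u v : modular F -> adj u v ->
  set_omega (F u) + set_omega (F v) <= set_omega (\bigcup_v F v).
Proof.
move=> modF uv; apply: leq_trans (leq_omegaU (modular_adj modF uv)) _.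
by apply: leq_omegaS; rewrite subUset !bigcup_sup.
Qed.

Lemma leq_omega_modular_clique F Q : modular F -> clique Q ->
  \sum_(v in Q) set_omega (F v) <= set_omega (\bigcup_(v in Q) F v).
Proof.
move=> modF; have [m] := ubnP #|Q|; elim: m Q => // m IHm Q leQm /cliqueP cQ.
have [->|[v vQ]] := set_0Vmem Q; first by rewrite !big_set0.
rewrite !(big_setD1 v vQ) /= (leq_trans _ (leq_omegaU _)) //.
  rewrite leq_add2l; apply: IHm; first by move: leQm; rewrite (cardsD1 v Q) vQ.
  by apply/cliqueP=> x y /setD1P[_ xQ] /setD1P[_ yQ]; apply: cQ.
move=> x y xFv /bigcupP[u /setD1P[uv uQ] yFu].
by apply: (modular_adj modF _ xFv yFu); apply: cQ; rewrite // eq_sym.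
Qed.

Lemma leq_chi_modular F W : modular F ->
  set_chi (\bigcup_(v in W) F v) <= set_chi W * \max_(v in W) set_chi (F v).
Proof.
move=> modF; set m := \max_(v in W) _.
have [c c_lt c_proper] := (set_chi_leP W _).2 (leqnn _).
pose color_class i := [pred v in W | c v == i].
have cover : \bigcup_(v in W) F v \subset
    \bigcup_(i < set_chi W) \bigcup_(v in color_class i) F v.
  apply/bigcupsP=> v vW; apply: (bigcup_max (Ordinal (c_lt v vW))) => //.
  by apply: bigcup_sup; rewrite inE vW /=.
apply: leq_trans (leq_chiS cover) _; apply: leq_trans (leq_chi_bigcup _ _) _.
rewrite -[X in X * m]card_ord -sum_nat_const; apply: leq_sum => i _.
apply: leq_trans (leq_chi_bigcup_anticomplete _) _ => [u v|].
  rewrite !inE => /andP[uW /eqP cu] /andP[vW /eqP cv] uv x y xFu yFv.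
  rewrite (modF u v uv x y xFu yFv); apply/negP=> /(c_proper u v uW vW).
  by rewrite cu cv eqxx.
apply/bigmax_leqP=> v /andP[vW _].
exact: (leq_bigmax_cond (F := fun v => set_chi (F v))).
Qed.

End Modular.

Section Composable.
Variable f : nat -> nat.

Definition set_chi_bounded (G : sgraph) (S : {set G}) : Prop :=
  forall A : {set G}, A \subset S -> set_chi A <= f (set_omega A).

Definition composable (G : sgraph) : Prop :=
  forall (D : sgraph) (F : G -> {set D}), modular F ->
  (forall v, set_chi_bounded (F v)) -> set_chi_bounded (\bigcup_v F v).

Lemma set_chi_boundedS (G : sgraph) (S T : {set G}) :
  S \subset T -> set_chi_bounded T -> set_chi_bounded S.
Proof. by move=> sST bdT A sAS; apply: bdT (subset_trans sAS sST). Qed.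

Lemma set_chi_boundedU (G : sgraph) (S T : {set G}) :
  {homo f : m n / m <= n} -> anticomplete S T ->
  set_chi_bounded S -> set_chi_bounded T -> set_chi_bounded (S :|: T).
Proof.
move=> f_homo antiST bdS bdT A /setIidPl <-; rewrite setIUr.
apply: leq_trans (leq_chiU_anticomplete _) _.
  by move=> x y /setIP[_ xS] /setIP[_ yT]; apply: antiST.
rewrite geq_max; apply/andP; split.
  apply: leq_trans (bdS _ (subsetIr _ _)) _.
  by apply: f_homo; apply: leq_omegaS; apply: subsetUl.
apply: leq_trans (bdT _ (subsetIr _ _)) _.
by apply: f_homo; apply: leq_omegaS; apply: subsetUr.
Qed.

Lemma composable_iso (G H : sgraph) : isomorphic G H -> composable G -> composable H.
Proof.
move=> [h [[h' hK h'K] adj_h]] compG D F modF bdF.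
have -> : \bigcup_v F v = \bigcup_u F (h u).
  by apply: reindex; exists h' => v _.
apply: compG => [u v uv x y xFu yFv|v]; last exact: bdF.
by rewrite -adj_h; apply: modF => //; apply: contra_neq uv; apply: can_inj.
Qed.

Lemma composable_dunion (G1 G2 : sgraph) : {homo f : m n / m <= n} ->
  composable G1 -> composable G2 -> composable (dunion G1 G2).
Proof.
move=> f_homo comp1 comp2 D F modF bdF.
have -> : \bigcup_v F v = \bigcup_v F (inl v) :|: \bigcup_v F (inr v).
  exact: big_sumType.
apply: set_chi_boundedU => //.
- by move=> x y /bigcupP[u _ xFu] /bigcupP[v _ yFv]; rewrite (modF (inl u) (inr v)).
- by apply: comp1 => [u v uv x y|v]; [apply: modF | apply: bdF].
- by apply: comp2 => [u v uv x y|v]; [apply: modF | apply: bdF].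
Qed.

Lemma composable_substitute (G1 : sgraph) (u : G1) (G2 : sgraph) :
  composable G1 -> composable G2 -> composable (substitute u G2).
Proof.
move=> comp1 comp2 D F modF bdF.
pose Fu := \bigcup_a F (inr a).
pose F1 (v : G1) := if insub v is Some z then F (inl z) else Fu.
have bdFu : set_chi_bounded Fu.
  by apply: comp2 => [a b ab x y|a]; [apply: modF | apply: bdF].
apply: (@set_chi_boundedS _ _ (\bigcup_v F1 v)).
  apply/bigcupsP=> -[z|a] _.
    by apply: (bigcup_max (val z)); rewrite // /F1 valK.
  apply: (bigcup_max u); rewrite // /F1 insubF ?eqxx //.
  exact: bigcup_sup.
apply: comp1 => [v w vw x y|v]; last by rewrite /F1; case: insubP.
rewrite /F1; case: insubP => [s _ sv|/negPn/eqP vu];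
  case: insubP => [t _ tw|/negPn/eqP wu].
- move=> xFs yFt; rewrite (modF (inl s) (inl t)) //= ?sv ?tw //.
  by apply: contra_neq vw => -[st]; rewrite -sv -tw st.
- by move=> xFs /bigcupP[a _ yFa]; rewrite (modF (inl s) (inr a)) //= sv wu.
- by move=> /bigcupP[a _ xFa] yFt; rewrite (modF (inr a) (inl t)) //= tw vu adj_sym.
- by rewrite vu wu eqxx in vw.
Qed.

Lemma star_closure_composable (C : graph_class) (G : sgraph) :
  {homo f : m n / m <= n} -> (forall H, C H -> composable H) ->
  star_closure C G -> composable G.
Proof.
move=> f_homo compC.
elim=> {G} [G /compC //|G H iso_GH _|G1 G2 _ comp1 _ comp2|G1 u G2 _ _ comp1 _ comp2].
- exact: composable_iso.
- exact: composable_dunion.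
- exact: composable_substitute.
Qed.

Lemma composable_set_chi_bounded (G : sgraph) (S : {set G}) :
  {homo f : m n / m <= n} -> 0 < f 1 -> composable G -> set_chi_bounded S.
Proof.
move=> f_homo f1_gt0 compG.
apply: (@set_chi_boundedS _ _ (\bigcup_v [set v])).
  by apply/subsetP=> v _; apply/bigcupP; exists v; rewrite ?inE.
apply: compG => [u v _ x y /set1P-> /set1P-> //|v A sAv].
have [->|[x xA]] := set_0Vmem A; first by rewrite set_chi0.
have stA : stable A.
  by move=> y z /(subsetP sAv)/set1P-> /(subsetP sAv)/set1P->; rewrite adj_irrefl.
apply: leq_trans (leq_chi_stable stA) (leq_trans f1_gt0 _).
exact: f_homo (omega_gt0 xA).
Qed.

End Composable.

Section Recurrence.
Variables (f g : nat -> nat).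
Hypothesis f_homo : {homo f : m n / m <= n}.
Hypothesis recurrence : forall n, g n.-1 + n./2 * (f n * g n./2) <= g n.

Lemma recurrence_homo : {homo g : m n / m <= n}.
Proof.
apply: homo_leq => [//|l m n|n]; first exact: leq_trans.
exact: leq_trans (leq_addr _ _) (recurrence n.+1).
Qed.

Section Fibers.
Variables (G D : sgraph) (F : G -> {set D}).
Hypothesis modF : modular F.
Hypothesis G_bound : forall W : {set G}, set_chi W <= f (set_omega W).
Hypothesis F_bound : forall v, set_chi (F v) <= g (set_omega (F v)).
Let n := set_omega (\bigcup_v F v).

Lemma leq_chi_fibers (W : {set G}) k m :
  set_chi W <= k -> {in W, forall v, set_omega (F v) <= m} ->
  set_chi (\bigcup_(v in W) F v) <= k * g m.
Proof.
move=> chiW leFm; apply: leq_trans (leq_chi_modular _ modF) _.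
apply: leq_mul chiW _; apply/bigmax_leqP=> v vW.
exact: leq_trans (F_bound v) (recurrence_homo (leFm v vW)).
Qed.

Lemma leq_chi_heavy_fibers (W : {set G}) m :
  {in W, forall v, n./2 < set_omega (F v) <= m} ->
  set_chi (\bigcup_(v in W) F v) <= g m.
Proof.
move=> heavyW; rewrite -[g m]mul1n; apply: leq_chi_fibers => [|v /heavyW/andP[] //].
apply: leq_chi_stable => u v uW vW; apply/negP=> /(leq_omega_modular_adj modF).
by rewrite -/n; have := heavyW u uW; have := heavyW v vW; lia.
Qed.

Lemma leq_chi_equal_fibers (W : {set G}) j :
  0 < j -> {in W, forall v, set_omega (F v) = j} ->
  set_chi (\bigcup_(v in W) F v) <= f n * g j.
Proof.
move=> j_gt0 FWj; apply: leq_chi_fibers => [|v /FWj -> //].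
apply: leq_trans (G_bound W) (f_homo _).
have [Q [cQ /subsetP sQW <-]] := omega_attained W.
rewrite -sum1_card; apply: (@leq_trans (\sum_(v in Q) set_omega (F v))).
  by apply: leq_sum => v /sQW/FWj ->.
apply: leq_trans (leq_omega_modular_clique modF cQ) _; apply: leq_omegaS.
by apply/bigcupsP=> v _; apply: bigcup_sup.
Qed.

Lemma leq_chi_nonfull_fibers :
  set_chi (\bigcup_(v in [set v | 0 < set_omega (F v) < n]) F v) <= g n.
Proof.
pose heavy := [set v | n./2 < set_omega (F v) < n].
pose light (j : 'I_n./2) := [set v | set_omega (F v) == j.+1].
have cover : \bigcup_(v in [set v | 0 < set_omega (F v) < n]) F v \subset
    (\bigcup_(v in heavy) F v) :|: \bigcup_j \bigcup_(v in light j) F v.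
  apply/bigcupsP=> v; rewrite inE => /andP[Fv_gt0 Fv_lt].
  have [Fv_light|Fv_heavy] := leqP (set_omega (F v)) n./2; last first.
    by apply: subsetU; rewrite (bigcup_sup v) // inE Fv_heavy.
  have j_lt : (set_omega (F v)).-1 < n./2 by rewrite prednK.
  apply: subsetU; apply/orP; right; apply: (bigcup_max (Ordinal j_lt)) => //.
  by apply: bigcup_sup; rewrite inE /= prednK.
apply: leq_trans (leq_chiS cover) _; apply: leq_trans (leq_chiU _ _) _.
apply: leq_trans (recurrence n); apply: leq_add.
  by apply: leq_chi_heavy_fibers => v; rewrite inE; lia.
rewrite -[X in X * (_ * _)]card_ord -sum_nat_const.
apply: leq_trans (leq_chi_bigcup _ _) _; apply: leq_sum => j _.
apply: (@leq_trans (f n * g j.+1)); last by rewrite leq_mul2l recurrence_homo ?orbT.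
by apply: leq_chi_equal_fibers => // v; rewrite inE => /eqP.
Qed.

Lemma leq_chi_modular_recurrence : set_chi (\bigcup_v F v) <= g n.
Proof.
pose full := [set v | set_omega (F v) == n].
pose nonfull := [set v | 0 < set_omega (F v) < n].
have leFn v : set_omega (F v) <= n by apply: leq_omegaS; apply: bigcup_sup.
have cover : \bigcup_v F v \subset
    (\bigcup_(v in full) F v) :|: \bigcup_(v in nonfull) F v.
  apply/subsetP=> x /bigcupP[v _ xFv]; rewrite inE; apply/orP.
  have [v_full|v_nonfull] := eqVneq (set_omega (F v)) n; [left | right].
    by apply/bigcupP; exists v; rewrite // inE v_full.
  by apply/bigcupP; exists v; rewrite // inE (omega_gt0 xFv) ltn_neqAle v_nonfull leFn.
apply: leq_trans (leq_chiS cover) _; apply: leq_trans (leq_chiU_anticomplete _) _.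
  move=> x y /bigcupP[u + xFu] /bigcupP[v + yFv]; rewrite !inE => /eqP u_full
    v_nonfull.
  have uv : u != v by apply: contraTneq v_nonfull => <-; rewrite u_full ltnn andbF.
  rewrite (modF uv xFu yFv); apply/negP=> /(leq_omega_modular_adj modF).
  by rewrite -/n u_full; lia.
rewrite geq_max leq_chi_nonfull_fibers andbT.
have [n0|n_gt0] := posnP n.
  rewrite (leq_trans (leq_chiS (_ : _ \subset set0))) ?set_chi0 //.
  apply/subsetP=> x /bigcupP[v _ /omega_gt0]; have := leFn v; lia.
by apply: leq_chi_heavy_fibers => v; rewrite inE => /eqP->; lia.
Qed.

End Fibers.

Lemma composable_recurrence (G : sgraph) : set_chi_bounded f [set: G] -> composable g G.
Proof.
move=> bdG D F modF bdF A /setIidPr <-; rewrite big_distrl /=.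
apply: leq_chi_modular_recurrence; first exact: modularI.
  by move=> W; apply: bdG; apply: subsetT.
by move=> v; apply: bdF; apply: subsetIl.
Qed.

End Recurrence.

Lemma expn_recurrence K B n : 0 < K -> 2 * K ^ 3 < B ->
  B ^ n.-1 + n./2 * (K ^ n.+1 * B ^ n./2) <= B ^ n.
Proof.
move=> K_gt0 ltKB; have [n_le1|n_gt1] := leqP n 1.
  case: n n_le1 => [|[|]] // _; rewrite mul0n addn0 // expn_gt0.
  by rewrite (leq_ltn_trans _ ltKB).
pose h := (uphalf n).-1.
have le_h : n./2 * K ^ n.+1 <= 2 * K ^ 3 * B ^ h.
  apply: (@leq_trans ((2 * K ^ 3) ^ h.+1)).
    rewrite expnMn -expnM; apply: leq_mul; last by rewrite leq_pexp2l // /h; lia.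
    by apply: leq_trans (ltnW (ltn_expl _ (ltnSn 1))) _; rewrite leq_pexp2l // /h; lia.
  rewrite expnS leq_mul2l; case: (h) => [|i]; first by rewrite !expn0 orbT.
  by rewrite leq_exp2r // (ltnW ltKB) orbT.
have -> : B ^ n = B * (B ^ h * B ^ n./2) by rewrite -expnD -expnS; congr expn; lia.
have -> : B ^ n.-1 = B ^ h * B ^ n./2 by rewrite -expnD; congr expn; lia.
apply: leq_trans (leq_mul ltKB (leqnn _)); rewrite mulSn leq_add2l mulnA [leqRHS]mulnA.
exact: leq_mul le_h (leqnn _).
Qed.

Import Order.TTheory GRing.Theory Num.Theory.
Local Open Scope ring_scope.

Lemma exponential_le_expn (R : realType) (f : nat -> R) : exponential f ->
  exists2 K, (0 < K)%N & forall n, f n <= (K ^ n.+1)%:R.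
Proof.
move=> [a [b [a_gt0 b_gt1 fE]]].
have a_ge0 := ltW a_gt0; have b_ge0 : 0 <= b := ltW (lt_trans ltr01 b_gt1).
pose K := (Num.bound a + Num.bound b)%N.
have le_aK : a <= K%:R by rewrite natrD ler_wpDr // ltW // archi_boundP.
have le_bK : b <= K%:R by rewrite natrD ler_wpDl // ltW // archi_boundP.
exists K => [|n]; first by rewrite -(ltr_nat R); apply: lt_le_trans le_aK.
by rewrite fE natrX exprS ler_pM ?exprn_ge0 ?lerXn2r ?nnegrE ?ler0n.
Qed.

Lemma exponential_expn (R : realType) B : (1 < B)%N ->
  exponential (fun n => (B ^ n)%:R : R).
Proof.
by move=> B_gt1; exists 1, B%:R; split=> [||n]; rewrite ?ltr1n ?mul1r ?natrX.
Qed.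

Theorem theorem2p6 (R : realType) (C : graph_class) :
  (exists f : nat -> R, exponential f /\ chi_bounded_by C f) ->
  exists g : nat -> R, exponential g /\ chi_bounded_by (star_closure C) g.
Proof.
move=> [f [/exponential_le_expn[K K_gt0 le_fK] chi_f]].
pose B := (2 * K ^ 3).+1%N.
have B_gt1 : (1 < B)%N by rewrite ltnS muln_gt0 expn_gt0 K_gt0.
have expB_homo : {homo expn B : m n / (m <= n)%N} by move=> m n; apply: leq_pexp2l.
exists (fun n => (B ^ n)%:R); split; first exact: exponential_expn.
move=> G starG A; rewrite ler_nat.
apply: (composable_set_chi_bounded (S := A)) => //.
apply: star_closure_composable starG => // H CH.
apply: (composable_recurrence (f := fun n => (K ^ n.+1)%N)) => //.
- by move=> m n le_mn; apply: leq_pexp2l.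
- by move=> n; apply: expn_recurrence (ltnSn _).
- by move=> W _; rewrite -(ler_nat R); apply: le_trans (chi_f H CH W) (le_fK _).
Qed.
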